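(* Let $k\ge 2$ be an integer. If $G$ is a $2k$-connected, $1$-tough and $(P_{3}\cup kP_{1})$-free graph, then $G$ is Hamiltonian.
   Context: All graphs are finite, simple and undirected. The connectivity $\kappa(G)$ of a graph $G$ is the minimum size of a vertex set $S\subseteq V(G)$ such that $G-S$ is disconnected or has only one vertex; $G$ is $m$-connected if $\kappa(G)\ge m$. For a non-complete graph $G$, the toughness is $\tau(G)=\min\{|S|/c(G-S): S\subseteq V(G),\ c(G-S)\ge 2\}$, where $c(G-S)$ denotes the number of connected components of $G-S$; for complete graphs $\tau(G)=\infty$. A graph is $t$-tough if $\tau(G)\ge t$. $P_n$ denotes the path on $n$ vertices, $F_1\cup F_2$ denotes the disjoint union of vertex-disjoint graphs $F_1,F_2$, and $kP_1$ denotes $k$ disjoint copies of $P_1$ (so $P_3\cup kP_1$ is the disjoint union of a path on three vertices and $k$ isolated vertices). A graph $G$ is $F$-free if $G$ does not contain $F$ as an induced subgraph. A graph is Hamiltonian if it has a Hamiltonian cycle, i.e. a cycle containing every vertex exactly once. *)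

(* Defs.v *)
From HB Require Import structures.
From mathcomp Require Import all_boot all_order all_algebra.
From mathcomp Require Import constructive_ereal.

Set Implicit Arguments.
Unset Strict Implicit.
Unset Printing Implicit Defensive.

Import Order.TTheory GRing.Theory Num.Theory.

Record sgraph := SGraph {
  vertex :> finType;
  adj : rel vertex;
  adj_sym : symmetric adj;
  adj_irr : irreflexive adj }.

Section DeleteVertices.
Variables (G : sgraph) (S : {set G}).

Definition del_type : finType := {x : G | x \notin S}.
Definition del_rel : rel del_type := fun x y => adj (val x) (val y).

Lemma del_sym : symmetric del_rel.
Proof. by move=> x y; rewrite /del_rel adj_sym. Qed.

Lemma del_irr : irreflexive del_rel.
Proof. by move=> x; rewrite /del_rel adj_irr. Qed.

(* G - S *)
Definition del_verts : sgraph := SGraph del_sym del_irr.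
End DeleteVertices.

Definition num_comp (G : sgraph) : nat := n_comp (@adj G) G.

Definition disconnected (G : sgraph) : bool := 2 <= num_comp G.

(* The default value #|G| is never attained on a nonempty graph, where deleting
   all vertices but one is always admissible; it gives the empty graph
   connectivity 0. *)
Definition connectivity (G : sgraph) : nat :=
  \big[minn/#|G|]_(S : {set G} |
        disconnected (del_verts S) || (#|del_verts S| == 1)) #|S|.

Definition m_connected (m : nat) (G : sgraph) : bool := m <= connectivity G.

(* For a complete graph no S is admissible and the minimum is +oo. *)
Definition toughness (G : sgraph) : \bar rat :=
  \big[Order.min/+oo%E]_(S : {set G} | 2 <= num_comp (del_verts S))
     ((#|S|%:R / (num_comp (del_verts S))%:R)%R)%:E%E.

Definition tough (t : rat) (G : sgraph) : bool := (t%:E <= toughness G)%E.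

Section PathGraph.
Variable n : nat.

Definition path_rel : rel 'I_n := fun i j => (i.+1 == j) || (j.+1 == i).

Lemma path_sym : symmetric path_rel.
Proof. by move=> i j; rewrite /path_rel orbC. Qed.

Lemma path_irr : irreflexive path_rel.
Proof. by move=> i; rewrite /path_rel orbb gtn_eqF. Qed.

Definition path_graph : sgraph := SGraph path_sym path_irr.
End PathGraph.

Section DisjointUnion.
Variables F1 F2 : sgraph.

Definition union_rel : rel (F1 + F2)%type := fun u v =>
  match u, v with
  | inl x, inl y => adj x y
  | inr x, inr y => adj x y
  | _, _ => false
  end.

Lemma union_sym : symmetric union_rel.
Proof. by case=> x [] y //=; rewrite adj_sym. Qed.

Lemma union_irr : irreflexive union_rel.
Proof. by case=> x /=; rewrite adj_irr. Qed.

Definition disjoint_union : sgraph := SGraph union_sym union_irr.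
End DisjointUnion.

Section Copies.
Variables (k : nat) (F : sgraph).

Definition copies_rel : rel ('I_k * F)%type := fun u v =>
  (u.1 == v.1) && adj u.2 v.2.

Lemma copies_sym : symmetric copies_rel.
Proof. by move=> u v; rewrite /copies_rel eq_sym adj_sym. Qed.

Lemma copies_irr : irreflexive copies_rel.
Proof. by move=> u; rewrite /copies_rel adj_irr andbF. Qed.

(* kF: k disjoint copies of F *)
Definition copies : sgraph := SGraph copies_sym copies_irr.
End Copies.

Definition contains_induced (G F : sgraph) : Prop :=
  exists f : F -> G, injective f /\ forall x y, adj (f x) (f y) = adj x y.

Definition induced_free (F G : sgraph) : Prop := ~ contains_induced G F.

(* ucycle only asks for a duplicate-free closed walk, so it also accepts
   a single edge; the bound on the size excludes this. *)
Definition hamiltonian (G : sgraph) : Prop :=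
  exists c : seq G, [/\ ucycle (@adj G) c, 3 <= size c & forall x, x \in c].

(* Main.v *)
Require Import Defs.
From HB Require Import structures.
From mathcomp Require Import all_boot all_order all_algebra.
From mathcomp Require Import constructive_ereal zify.

(** Let [c] be a longest cycle, [h] a vertex off [c], [H] the component of
    [G - c] containing [h] and [A] the set of neighbours of [H] on [c]; writing
    [x+] for the successor of [x] on [c], the set [I = A+ + h] is independent
    and has at least [2k + 1] elements.  Call a vertex heavy if its closed
    neighbourhood meets [I] in at least two vertices.  As [G] is
    (P_3 + kP_1)-free, a heavy vertex is adjacent to all but at most [k - 1]
    vertices of [I], and deleting the set [T] of heavy vertices leaves a
    P_3-free graph, i.e. a disjoint union of cliques, because three light
    vertices see at most three of the [2k + 1] vertices of [I].  Since [c] is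
    longest, [T] lies on [c], contains no two consecutive vertices, and
    [T+ + h] is independent: each violation is excluded by a count of the
    rotations of [c] it would allow.  Hence [G - T] has at least [|T| + 1]
    components and [G] is not 1-tough. *)

Set Implicit Arguments.
Unset Strict Implicit.
Unset Printing Implicit Defensive.

(** * Walks with prescribed ends *)

Section Walk.
Variable T : eqType.
Implicit Types (e : rel T) (u v x y : T) (s d : seq T).

(** Both ends are listed in [s]: joining two walks by an edge is then concatenation, and a walk
    spans a cycle when its list is a permutation of it. *)
Definition walk e u v s :=
  if s is a :: s' then [&& a == u, path e a s' & last a s' == v] else false.

Lemma walk_cat e u v x y s d :
  walk e u v s -> e v x -> walk e x y d -> walk e u y (s ++ d).
Proof.
case: s => // a s /and3P[au ps /eqP lv] evx.
case: d => // b d /and3P[/eqP-> pd ld] /=.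
by rewrite au cat_path last_cat ps lv /= evx pd ld.
Qed.

Lemma walk_rev e u v s : symmetric e -> walk e u v s -> walk e v u (rev s).
Proof.
move=> sym_e; case: s => // a s /and3P[/eqP<- ps /eqP<-].
rewrite lastI rev_rcons /= eqxx rev_path.
under eq_path => x y do rewrite sym_e.
rewrite ps /=; case: s {ps} => //= b s; rewrite rev_cons last_rcons eqxx //.
Qed.

Lemma sub_walk e e' u v s : subrel e e' -> walk e u v s -> walk e' u v s.
Proof.
move=> ee'; case: s => // a s /and3P[/= -> ps ->].
by rewrite (sub_path ee' ps).
Qed.

Lemma walk_cycle e u v s : walk e u v s -> e v u -> cycle e s.
Proof.
by case: s => // a s /and3P[/eqP-> ps /eqP lv] evu; rewrite /= rcons_path ps lv.
Qed.

Lemma walk1 e u : walk e u u [:: u].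
Proof. by rewrite /= eqxx. Qed.

Lemma index_walk_last e u v d z :
  uniq d -> walk e u v d -> z \in d -> index z d <= index v d.
Proof.
case: d => // a d Ud /and3P[_ _ /eqP<-]; rewrite -index_mem.
by rewrite index_last.
Qed.

End Walk.

(** * Cutting a cycle into arcs *)

Section Arcs.
Variables (T : eqType) (e : rel T) (f : T -> T).
Let ef := [rel x y | e x y && (f x == y)].

(** The cut falls between [x] and [f x]. By the last clause positions beyond [x] are only shifted,
    so that later cuts can be made inside the second piece. *)
Lemma arc_cut u v d x : uniq d -> walk ef u v d -> x \in d -> x != v ->
  exists d1 d2, [/\ d = d1 ++ d2, walk ef u x d1, walk ef (f x) v d2 &
    forall z, z \in d -> index x d < index z d ->
      z \in d2 /\ index z d = size d1 + index z d2].
Proof.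
move=> Ud Wd xd; case/splitPr: xd Ud Wd => p q Ud Wd xv.
case: q => [|y q] in Ud Wd *.
  case: p Wd {Ud} => [|a p] /=; first by rewrite (negPf xv) andbF.
  by rewrite last_cat /= (negPf xv) !andbF.
exists (rcons p x), (y :: q).
have E : rcons p x ++ y :: q = p ++ [:: x, y & q] by rewrite cat_rcons.
have xp : x \notin p.
  by apply/negP=> xp; move: Ud; rewrite cat_uniq /= xp /= !andbF.
split=> //.
- case: p Wd {Ud E xp} => [|a p] /=; first by case/and3P=> -> /=; rewrite eqxx.
  case/and3P=> -> ; rewrite cat_path rcons_path last_rcons eqxx /=.
  by case/andP=> -> /andP[-> _].
- case: p Wd {Ud E xp} => [|a p] /=.
    by case/and3P=> _ /andP[/andP[_ /eqP->] ->] ->; rewrite eqxx.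
  rewrite cat_path last_cat /=.
  by case/and3P=> _ /andP[_ /andP[_ /andP[/andP[_ /eqP->] ->]]] ->; rewrite eqxx.
move=> z; rewrite -E => zd.
have -> : index x (rcons p x ++ y :: q) = size p.
  by rewrite E index_cat (negPf xp) /= eqxx addn0.
move: zd; rewrite mem_cat index_cat; case: ifP => [zp _|_ /= zd _]; last by split.
by move: zp; rewrite -index_mem size_rcons; lia.
Qed.

Lemma arc_cut2 u v d x y : uniq d -> walk ef u v d -> x \in d -> y \in d ->
    index x d < index y d -> y != v ->
  exists d1 d2 d3, [/\ d = d1 ++ d2 ++ d3, walk ef u x d1,
    walk ef (f x) y d2, walk ef (f y) v d3 &
    forall z, z \in d -> index y d < index z d -> z \in d3].
Proof.
move=> Ud Wd xd yd xy yv.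
have xv : x != v.
  by apply: contraTneq xy => ->; rewrite -leqNgt (index_walk_last Ud Wd).
have [d1 [d2 [Ed W1 W2 H]]] := arc_cut Ud Wd xd xv.
have [yd2 Ey] := H y yd xy.
have Ud2 : uniq d2 by move: Ud; rewrite Ed cat_uniq => /and3P[].
have [d3 [d4 [Ed2 W3 W4 H2]]] := arc_cut Ud2 W2 yd2 yv.
exists d1, d3, d4; split=> // [|z zd yz]; first by rewrite Ed Ed2.
have [zd2 Ez] := H z zd (ltn_trans xy yz).
by have [|//] := H2 z zd2; move: yz; rewrite Ey Ez ltn_add2l.
Qed.

Lemma arc_cut3 u v d x y z : uniq d -> walk ef u v d ->
    x \in d -> y \in d -> z \in d ->
    index x d < index y d -> index y d < index z d -> z != v ->
  exists d1 d2 d3 d4, [/\ d = d1 ++ d2 ++ d3 ++ d4, walk ef u x d1,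
    walk ef (f x) y d2, walk ef (f y) z d3 & walk ef (f z) v d4].
Proof.
move=> Ud Wd xd yd zd xy yz zv.
have yv : y != v.
  by apply: contraTneq yz => ->; rewrite -leqNgt (index_walk_last Ud Wd).
have [d1 [d2 [d3 [Ed W1 W2 W3 H]]]] := arc_cut2 Ud Wd xd yd xy yv.
have zd3 := H z zd yz.
have Ud3 : uniq d3 by move: Ud; rewrite Ed !cat_uniq => /and3P[_ _ /and3P[]].
have [d4 [d5 [Ed3 W4 W5 _]]] := arc_cut Ud3 W3 zd3 zv.
by exists d1, d2, d4, d5; rewrite Ed Ed3.
Qed.

(** Rotating [c] until [s] comes last opens the cycle between [s] and [f s]. *)
Lemma arc_open c s : cycle ef c -> s \in c ->
  exists2 d, perm_eq d c & walk ef (f s) s d.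
Proof.
move=> Cc sc; have [i p Ep] := rot_to sc.
have Cd : cycle ef (rot 1 (s :: p)) by rewrite rot_cycle -Ep rot_cycle.
exists (rot 1 (s :: p)).
  by rewrite perm_rot -Ep perm_rot.
move: Cd; rewrite rot1_cons; case: p {Ep} => [|a p] /=.
  by case/andP=> /andP[_ /eqP->]; rewrite eqxx.
rewrite rcons_path last_rcons eqxx /= => /and3P[-> _ /eqP->].
by rewrite eqxx.
Qed.

End Arcs.

(** Let [x] be the first element satisfying [p]. Every other element fails [p], or comes after [x]
    and fails [q]; the summand 1 pays for [x]. *)
Lemma card_threshold (T : finType) (J : {set T}) (p q : pred T) (pos : T -> nat) :
    {in J &, injective pos} ->
    {in J &, forall x y, pos x < pos y -> p x -> ~~ q y} ->
  #|J| <= #|[set x in J | ~~ p x]| + #|[set x in J | ~~ q x]| + 1.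
Proof.
move=> inj_pos H.
have [x0 /andP[x0J px0]|no_p] := pickP [pred x in J | p x]; last first.
  suff -> : [set x in J | ~~ p x] = J by lia.
  apply/setP=> x; rewrite !inE; case xJ: (x \in J) => //=.
  by have := no_p x; rewrite /= xJ /= => ->.
have P0 : (x0 \in J) && p x0 by rewrite x0J.
have [x /andP[xJ px] x_min] := arg_minnP (P := [pred x in J | p x]) pos P0.
rewrite (cardsD1 x) xJ addnC leq_add2r.
apply: leq_trans (leq_card_setU _ _); apply/subset_leq_card/subsetP=> y.
rewrite !inE => /andP[yx yJ]; rewrite yJ /=.
case py: (p y) => //=; apply: (H x) => //.
have: pos x <= pos y by apply: x_min; rewrite /= yJ.
rewrite leq_eqVlt => /orP[/eqP/inj_pos E|//].
by rewrite E ?eqxx in yx.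
Qed.

(** * Components, connectivity, toughness and the forbidden subgraph *)

Lemma adj_connect_sym (G : sgraph) : connect_sym (@adj G).
Proof. exact/sym_connect_sym/adj_sym. Qed.

Lemma num_comp_ge (G : sgraph) (I : {set G}) :
  {in I &, forall x y, connect (@adj G) x y -> x = y} -> #|I| <= num_comp G.
Proof.
move=> H; rewrite -(card_in_imset (f := fingraph.root (@adj G)) (D := I)).
  apply: subset_leq_card; apply/subsetP=> _ /imsetP[x _ ->].
  by rewrite !inE roots_root //; apply: adj_connect_sym.
move=> x y xI yI /eqP; rewrite root_connect; last exact: adj_connect_sym.
exact: H.
Qed.

Lemma num_comp_del_ge (G : sgraph) (S I : {set G}) : [disjoint I & S] ->
    (forall x y : del_verts S, val x \in I -> val y \in I ->
       connect (@adj (del_verts S)) x y -> x = y) ->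
  #|I| <= num_comp (del_verts S).
Proof.
move=> dIS H.
have -> : #|I| = #|[set u : del_verts S | val u \in I]|.
  rewrite -(card_imset _ val_inj); apply: eq_card => x.
  apply/idP/imsetP => [xI|[u]]; last by rewrite inE => uI ->.
  have xS : x \notin S by rewrite (disjointFr dIS).
  by exists (Sub x xS : del_verts S); rewrite ?inE SubK.
by apply: num_comp_ge => x y; rewrite !inE; apply: H.
Qed.

Lemma m_connected_cut (G : sgraph) m (S : {set G}) : m_connected m G ->
  2 <= num_comp (del_verts S) -> m <= #|S|.
Proof.
move=> /leq_trans + H; apply; rewrite /connectivity.
have: S \in index_enum _ by rewrite mem_index_enum.
elim: (index_enum _) => // X r IH; rewrite inE big_cons.
case/orP=> [/eqP<-|/IH le]; first by rewrite /disconnected H geq_minl.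
by case: ifP => // _; rewrite geq_min le orbT.
Qed.

Lemma m_connected_card (G : sgraph) m : m_connected m G -> m <= #|G|.
Proof.
move=> /leq_trans; apply; rewrite /connectivity.
elim: (index_enum _) => [|X r IH]; rewrite ?big_nil // big_cons.
by case: ifP => // _; rewrite geq_min IH orbT.
Qed.

Lemma tough1_cut (G : sgraph) (S : {set G}) : tough 1%R G ->
  2 <= num_comp (del_verts S) -> num_comp (del_verts S) <= #|S|.
Proof.
move=> Ht H; have: (1%:E <= ((#|S|%:R / (num_comp (del_verts S))%:R)%R : rat)%:E)%E.
  apply: Order.POrderTheory.le_trans Ht _.
  by rewrite /toughness; apply: Order.TotalTheory.bigmin_le_cond.
rewrite lee_fin Num.Theory.ler_pdivlMr ?Num.Theory.ltr0n; last lia.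
by rewrite GRing.mul1r Num.Theory.ler_nat.
Qed.

Lemma P3_kP1_free_card (G : sgraph) k (a b c : G) (M : {set G}) :
    induced_free (disjoint_union (path_graph 3) (copies k (path_graph 1))) G ->
    adj a b -> adj b c -> a != c -> ~~ adj a c ->
    {in M &, forall x y, ~~ adj x y} ->
    {in M, forall x, [&& ~~ adj a x, ~~ adj b x & ~~ adj c x]} ->
  #|M| < k.
Proof.
move=> Hf ab bc ac nac indM nM; rewrite ltnNge; apply/negP=> leM; apply: Hf.
pose w i := nth a [:: a; b; c] i.
pose m (j : 'I_k) := nth a (enum M) j.
have mM j : m j \in M.
  by rewrite -mem_enum mem_nth // -cardE (leq_trans (ltn_ord j)).
have m_inj : injective m.
  move=> i j /eqP; rewrite nth_uniq ?enum_uniq // -?cardE.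
  - by move/eqP/val_inj.
  - exact: leq_trans (ltn_ord i) leM.
  - exact: leq_trans (ltn_ord j) leM.
have ba : adj b a by rewrite adj_sym.
have cb : adj c b by rewrite adj_sym.
have nca : ~~ adj c a by rewrite adj_sym.
have nwm (i : 'I_3) j : ~~ adj (w i) (m j).
  by have /and3P[] := nM _ (mM j); case: i => [[|[|[|]]]].
(* A vertex of [M] lying on the path would be adjacent to its neighbour there, against [nM]. *)
have wm (i : 'I_3) j : w i != m j.
  have /and3P[na nb nc] := nM _ (mM j).
  apply/eqP=> E; case: i E => [[|[|[|]]]] //= ? E; rewrite -E in na nb nc.
  - by rewrite ba in nb.
  - by rewrite ab in na.
  - by rewrite bc in nb.
have aNb : a != b by apply: contraTneq ab => ->; rewrite adj_irr.
have bNc : b != c by apply: contraTneq bc => ->; rewrite adj_irr.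
exists (fun u : disjoint_union (path_graph 3) (copies k (path_graph 1)) =>
  match u with inl i => w i | inr p => m p.1 end); split.
- case=> [i|[j z]] [i'|[j' z']] /=.
  + move=> E; congr inl; apply/val_inj; move: i i' E; rewrite /w.
    by case=> [[|[|[|]]] ?] // [[|[|[|]]] ?] //= /eqP;
      rewrite ?(negPf aNb) ?(negPf bNc) ?(negPf ac) // eq_sym
        ?(negPf aNb) ?(negPf bNc) ?(negPf ac).
  + by move=> E; have := wm i j'; rewrite E eqxx.
  + by move=> E; have := wm i' j; rewrite E eqxx.
  + by move/m_inj->; rewrite [z]ord1 [z']ord1.
- case=> [i|[j z]] [i'|[j' z']] /=.
  + case: i i' => [[|[|[|]]] ?] // [[|[|[|]]] ?] //=;
    by rewrite /path_rel /w /= ?adj_irr ?ab ?bc ?ba ?cb ?(negPf nac) ?(negPf nca).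
  + exact: negPf (nwm _ _).
  + by rewrite adj_sym; apply: negPf (nwm _ _).
  + rewrite (negPf (indM _ _ (mM _) (mM _))) /copies_rel /=.
    by rewrite [z]ord1 [z']ord1 /path_rel /= andbF.
Qed.

(** * A longest cycle and its rotations *)

Section LongestCycle.
Variables (G : sgraph) (c : seq G) (h : G).
Hypotheses (c_cycle : cycle (@adj G) c) (c_uniq : uniq c).
Hypothesis c_max : forall s : seq G, cycle (@adj G) s -> uniq s -> size s <= size c.
Hypothesis h_out : h \notin c.

Notation nx := (next c).

Let arc := [rel x y : G | adj x y && (nx x == y)].
Let off := [rel u v : G | [&& adj u v, u \notin c & v \notin c]].

Definition off_comp : {set G} := [set v | connect off h v].

Definition attach : {set G} := [set x in c | [exists v in off_comp, adj x v]].

Lemma attachP x :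
  reflect (x \in c /\ exists2 v, v \in off_comp & adj x v) (x \in attach).
Proof. by rewrite inE; apply: (iffP andP) => -[xc /exists_inP]. Qed.

Lemma attach_cycle x : x \in attach -> x \in c.
Proof. by case/attachP. Qed.

Lemma off_comp_h : h \in off_comp.
Proof. by rewrite inE connect0. Qed.

Lemma off_sym : symmetric off.
Proof. by move=> x y /=; rewrite adj_sym [(_ \notin _) && _]andbC. Qed.

Lemma off_path u p : u \notin c -> path off u p -> {in u :: p, forall z, z \notin c}.
Proof.
elim: p u => [|v p IH] u uc /=; first by move=> _ z; rewrite inE => /eqP->.
case/andP=> /and3P[_ _ vc] pv z; rewrite inE => /predU1P[->//|].
exact: IH pv z.
Qed.

Lemma off_comp_notin v : v \in off_comp -> v \notin c.
Proof.
rewrite inE => /connectP[p pp ->]; apply: (off_path h_out pp).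
exact: mem_last.
Qed.

Lemma off_comp_step u v :
  u \in off_comp -> adj u v -> v \notin c -> v \in off_comp.
Proof.
move=> uH uv vc; have uc := off_comp_notin uH; move: uH; rewrite !inE => hu.
by apply: connect_trans hu (connect1 _); rewrite /= uv uc vc.
Qed.

(** The neighbours of [x] and [y] in the component are linked through [h], and the link is shortened
    to a path. As a walk, [q] is nonempty, which makes the closed-up cycle strictly longer. *)
Lemma detour x y : x \in attach -> y \in attach ->
  exists a b q, [/\ walk (@adj G) a b q, adj x a, adj b y, uniq q
                 & {subset q <= off_comp}].
Proof.
case/attachP=> xc [a aH xa] /attachP[yc [b bH yb]].
have: connect off a b.
  apply: (@connect_trans _ _ h); last by move: bH; rewrite inE.
  by rewrite sym_connect_sym; [move: aH; rewrite inE | exact: off_sym].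
case/connectP=> p0 pp0 Eb; case/shortenP: pp0 Eb => p pp Up _ Eb.
exists a, b, (a :: p); split=> //.
- rewrite /= eqxx -Eb eqxx andbT; apply: sub_path pp => u v.
  by case/and3P.
- by rewrite adj_sym.
- move=> z zp; move: aH; rewrite !inE => /connect_trans; apply.
  exact: path_connect pp _ zp.
Qed.

(* Such a walk closes up through [off_comp] to a cycle longer than [c]; every
   rotation argument below ends here.  The extra vertices [r] lie in other
   components of [G - c]. *)
Lemma no_spanning_walk x y s r : x \in attach -> y \in attach ->
    walk (@adj G) y x s -> perm_eq s (c ++ r) -> uniq r ->
    {in r, forall z, z \notin c /\ z \notin off_comp} -> False.
Proof.
move=> xA yA Ws Ps Ur Hr.
have [a [b [q [Wq xa bny Uq qH]]]] := detour xA yA.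
have Wsq := walk_cat Ws xa Wq.
have := c_max (walk_cycle Wsq bny).
rewrite size_cat (perm_size Ps) size_cat.
case: q Wq Uq qH Wsq => // q0 q _ Uq qH _ H.
suff /H : uniq (s ++ q0 :: q) by rewrite /= -addnA -[leqRHS]addn0 leq_add2l addnS.
rewrite cat_uniq (perm_uniq Ps) cat_uniq c_uniq Ur Uq !andbT.
apply/andP; split.
  by apply/hasPn=> z /Hr[].
apply/hasPn=> z /qH zH; rewrite /= (perm_mem Ps) mem_cat.
rewrite (negPf (off_comp_notin zH)) /=.
by apply/negP=> /Hr[_]; rewrite zH.
Qed.

Lemma no_spanning_walk0 x y s : x \in attach -> y \in attach ->
  walk (@adj G) y x s -> perm_eq s c -> False.
Proof.
move=> xA yA Ws Ps; apply: (no_spanning_walk (r := [::]) xA yA Ws) => //.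
by rewrite cats0.
Qed.

Lemma cycle_arc : cycle arc c.
Proof.
have := cycle_next c_uniq; rewrite /arc.
set f := next c; move: f c_cycle => f.
case: (c) => // a p /= ca cf; rewrite path_relI ca; exact: cf.
Qed.

Lemma arcW u v s : walk arc u v s -> walk (@adj G) u v s.
Proof. by apply: sub_walk => x y /andP[]. Qed.

Lemma arcR u v s : walk arc u v s -> walk (@adj G) v u (rev s).
Proof. by move/arcW; apply: walk_rev; apply: adj_sym. Qed.

Lemma next_injective : injective nx.
Proof. exact: can_inj (prev_next c_uniq). Qed.

Lemma adj_next x : x \in c -> adj x (nx x).
Proof. exact: next_cycle. Qed.

(** Rearranged arcs are compared with the cycle by counting, which ignores order and reversals. *)
Ltac perm_pieces Pd Ed :=
  apply/permP=> P; move/permP/(_ P): Pd;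
  rewrite Ed !count_cat ?count_rev /=; clear; lia.

Lemma attach_next x : x \in attach -> nx x \notin attach.
Proof.
move=> xA; apply/negP=> nA.
have [d Pd Wd] := arc_open cycle_arc (attach_cycle xA).
exact: no_spanning_walk0 xA nA (arcW Wd) Pd.
Qed.

(** A chord from x+ to y+ gives the spanning walk y ... x+, y+ ... x, whose first arc is
    reversed. *)
Lemma attach_next_indep x y : x \in attach -> y \in attach -> x != y ->
  ~~ adj (nx x) (nx y).
Proof.
move=> xA yA xy; apply/negP=> e.
have [d Pd Wd] := arc_open cycle_arc (attach_cycle xA).
have Ud : uniq d by rewrite (perm_uniq Pd).
have yd : y \in d by rewrite (perm_mem Pd) attach_cycle.
rewrite eq_sym in xy.
have [s1 [s2 [Ed W1 W2 _]]] := arc_cut Ud Wd yd xy.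
apply: (no_spanning_walk0 xA yA (walk_cat (arcR W1) e (arcW W2))).
perm_pieces Pd Ed.
Qed.

(** The same rotation with [v] inserted between x+ and y+. The vertex [v] lies outside [off_comp],
    since otherwise x+ would be in [attach]; so it does not meet the detour. *)
Lemma attach_next_off v x y : x \in attach -> y \in attach -> x != y ->
  v \notin c -> adj v (nx x) -> adj v (nx y) -> False.
Proof.
move=> xA yA xy vc vx vy.
have [d Pd Wd] := arc_open cycle_arc (attach_cycle xA).
have Ud : uniq d by rewrite (perm_uniq Pd).
have yd : y \in d by rewrite (perm_mem Pd) attach_cycle.
have vH : v \notin off_comp.
  apply/negP=> vH; case/negP: (attach_next xA); apply/attachP.
  by rewrite mem_next attach_cycle //; split=> //; exists v; rewrite // adj_sym.
have yx : y != x by rewrite eq_sym.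
have [s1 [s2 [Ed W1 W2 _]]] := arc_cut Ud Wd yd yx.
have xv : adj (nx x) v by rewrite adj_sym.
have W := walk_cat (walk_cat (arcR W1) xv (walk1 (@adj G) v)) vy (arcW W2).
apply: (no_spanning_walk (r := [:: v]) xA yA W) => //.
  perm_pieces Pd Ed.
by move=> z; rewrite inE => /eqP->.
Qed.

(** * Rotations of the cycle opened after [s], with positions counted from s+ *)

Section Base.
Variables (s : G) (d : seq G).
Hypotheses (Pd : perm_eq d c) (Wd : walk arc (nx s) s d).

Let Ud : uniq d. Proof. by rewrite (perm_uniq Pd). Qed.
Let attd x : x \in attach -> x \in d.
Proof. by move/attach_cycle; rewrite (perm_mem Pd). Qed.

Lemma index_base_inj : {in attach &, injective (index^~ d)}.
Proof. by move=> x y xA yA E; rewrite -(nth_index x (attd xA)) E nth_index ?attd. Qed.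

(** The spanning walk is y ... x+, s ... y+, s+ ... x. *)
Lemma consecutive_crossing x y : x \in attach -> y \in attach ->
  s \notin attach -> index x d < index y d ->
  adj s (nx x) -> adj (nx s) (nx y) -> False.
Proof.
move=> xA yA sA xy sx sy.
have ys : y != s by apply: contraNneq sA => <-.
have [s1 [s2 [s3 [Ed W1 W2 W3 _]]]] := arc_cut2 Ud Wd (attd xA) (attd yA) xy ys.
rewrite adj_sym in sx; rewrite adj_sym in sy.
apply: (no_spanning_walk0 xA yA
  (walk_cat (walk_cat (arcR W2) sx (arcR W3)) sy (arcW W1))).
perm_pieces Pd Ed.
Qed.

Section Chord.
Variable t : G.
Hypotheses (tc : t \in c) (ts : t != s) (st : adj (nx s) (nx t)).

Let td : t \in d. Proof. by rewrite (perm_mem Pd). Qed.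

(** The spanning walk is y ... x+, t ... y+, s ... t+, s+ ... x. *)
Lemma chord_crossing_before x y : x \in attach -> y \in attach ->
  index x d < index y d -> index y d < index t d ->
  adj t (nx x) -> adj s (nx y) -> False.
Proof.
move=> xA yA xy yt tx sy.
have [s1 [s2 [s3 [s4 [Ed W1 W2 W3 W4]]]]] :=
  arc_cut3 Ud Wd (attd xA) (attd yA) td xy yt ts.
rewrite adj_sym in tx; rewrite adj_sym in sy.
have st' : adj (nx t) (nx s) by rewrite adj_sym.
apply: (no_spanning_walk0 xA yA (walk_cat (walk_cat (walk_cat (arcR W2) tx
  (arcR W3)) sy (arcR W4)) st' (arcW W1))).
perm_pieces Pd Ed.
Qed.

(** The spanning walk is x ... y+, s ... x+, t ... s+, t+ ... y. *)
Lemma chord_crossing_after x y : x \in attach -> y \in attach ->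
  s \notin attach ->
  index t d < index y d -> index y d < index x d ->
  adj s (nx y) -> adj t (nx x) -> False.
Proof.
move=> xA yA sA ty yx sy tx.
have xs : x != s by apply: contraNneq sA => <-.
have [s1 [s2 [s3 [s4 [Ed W1 W2 W3 W4]]]]] :=
  arc_cut3 Ud Wd td (attd yA) (attd xA) ty yx xs.
rewrite adj_sym in tx; rewrite adj_sym in sy.
apply: (no_spanning_walk0 yA xA (walk_cat (walk_cat (walk_cat (arcR W3) sy
  (arcR W4)) tx (arcR W1)) st (arcW W2))).
perm_pieces Pd Ed.
Qed.

(** Here [t] itself serves as an end: the spanning walk is t ... x+, s ... t+, s+ ... x. *)
Lemma chord_attach_before x : x \in attach -> t \in attach ->
  index x d < index t d -> adj s (nx x) -> False.
Proof.
move=> xA tA xt sx.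
have [s1 [s2 [s3 [Ed W1 W2 W3 _]]]] := arc_cut2 Ud Wd (attd xA) td xt ts.
rewrite adj_sym in sx.
have st' : adj (nx t) (nx s) by rewrite adj_sym.
apply: (no_spanning_walk0 xA tA
  (walk_cat (walk_cat (arcR W2) sx (arcR W3)) st' (arcW W1))).
perm_pieces Pd Ed.
Qed.

End Chord.
End Base.

(** Deleting [attach] separates [h] from every remaining vertex of the cycle, because [off_comp] has
    no other neighbours on [c]. *)
Lemma attach_card m : m_connected m G -> 0 < size c -> m <= #|attach|.
Proof.
move=> Gm c0; apply: m_connected_cut Gm _.
(* The successor of a vertex of [attach] serves as [z]; if [attach] is empty, any cycle vertex
   does. *)
have [z zc zA] : exists2 z, z \in c & z \notin attach.
  have [x xA|A0] := pickP (mem attach).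
    by exists (nx x); rewrite ?attach_next // mem_next attach_cycle.
  case: (c) c0 A0 => // a p _ A0; exists a; rewrite ?mem_head //.
  exact: negbT (A0 a).
have hz : h != z by apply: contraNneq h_out => ->.
rewrite -[2]/(true.+1) -hz -cards2.
have hA : h \notin attach by apply: contra h_out => /attach_cycle.
apply: num_comp_del_ge.
  by rewrite disjoint_subset; apply/subsetP=> x; rewrite !inE => /orP[]/eqP->;
     move: hA zA; rewrite !inE.
have cl : closed (@adj (del_verts attach)) [pred u | val u \in off_comp].
  apply: intro_closed; first exact: adj_connect_sym.
  move=> u v uv; rewrite -!topredE /= => uH.
  have vA := valP v; apply: (off_comp_step uH uv).
  apply: contra vA => vc; apply/attachP; split=> //.
  by exists (val u); rewrite // adj_sym; apply: uv.
move=> x y xI yI /(closed_connect cl); rewrite -!topredE /= => E.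
apply: val_inj; move: xI yI E; rewrite !in_set2.
have zH : z \in off_comp = false by apply: contraTF zc => /off_comp_notin.
by case/orP=> /eqP Ex /orP[]/eqP Ey; rewrite Ex Ey ?off_comp_h ?zH // => _;
  apply: etrans Ex (esym Ey).
Qed.

(** * Heavy vertices and the failure of toughness *)

Section Tough.
Variable k : nat.
Hypotheses (k2 : 2 <= k) (A2k : 2 * k <= #|attach|).
Hypothesis hfree :
  induced_free (disjoint_union (path_graph 3) (copies k (path_graph 1))) G.

Definition anchors : {set G} := h |: nx @: attach.

Definition heavy : {set G} :=
  [set v | 1 < #|[set w in anchors | (w == v) || adj v w]|].

(** Missed successors x+ are recorded by [x], so that they can be counted along the order of
    [attach] on the cycle. *)
Definition missed v : {set G} := [set x in attach | ~~ adj v (nx x)].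

Lemma h_notin_next (B : {set G}) : B \subset c -> h \notin nx @: B.
Proof.
move=> Bc; apply: contra h_out => /imsetP[x xB ->].
by rewrite mem_next; apply: (subsetP Bc).
Qed.

Lemma attach_sub : attach \subset c.
Proof. by apply/subsetP=> x; apply: attach_cycle. Qed.

Lemma card_anchors : #|anchors| = #|attach|.+1.
Proof.
by rewrite cardsU1 h_notin_next ?attach_sub // card_imset //; apply: next_injective.
Qed.

Lemma h_next_nadj x : x \in attach -> ~~ adj h (nx x).
Proof.
move=> xA; apply: contra (attach_next xA) => hx; apply/attachP.
rewrite mem_next attach_cycle //; split=> //; exists h; first exact: off_comp_h.
by rewrite adj_sym.
Qed.

Lemma anchors_indep : {in anchors &, forall x y, ~~ adj x y}.
Proof.
move=> x y /setU1P[->|/imsetP[x' x'A ->]] /setU1P[->|/imsetP[y' y'A ->]].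
- by rewrite adj_irr.
- exact: h_next_nadj.
- by rewrite adj_sym h_next_nadj.
- have [->|xy] := eqVneq x' y'; first by rewrite adj_irr.
  exact: attach_next_indep.
Qed.

(** An anchor that equals [v] would be adjacent to the other witness, against independence; so both
    witnesses are proper neighbours. *)
Lemma heavyP v : v \in heavy -> exists x y,
  [/\ x \in anchors, y \in anchors, x != y, adj v x & adj v y].
Proof.
rewrite in_set => /card_gt1P[x [y [/setIdP[xI xv] /setIdP[yI yv] xy]]].
exists x, y.
have [Ex|xNv] := eqVneq x v.
  move: yv; rewrite -Ex eq_sym (negPf xy) /= => e.
  by have := anchors_indep xI yI; rewrite e.
have [Ey|yNv] := eqVneq y v.
  move: xv; rewrite -Ey (negPf xy) /= => e.
  by have := anchors_indep yI xI; rewrite e.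
by move: xv yv; rewrite (negPf xNv) (negPf yNv).
Qed.

Lemma heavyI v x y : x \in anchors -> y \in anchors -> x != y ->
  adj v x -> adj v y -> v \in heavy.
Proof.
move=> xI yI xy vx vy; rewrite in_set; apply/card_gt1P; exists x, y.
by split=> //; apply/setIdP; rewrite ?vx ?vy orbT.
Qed.

Lemma heavy_anchors : [disjoint anchors & heavy].
Proof.
rewrite disjoint_subset; apply/subsetP=> v vI; apply/negP=> /heavyP[x [y [xI _ _ vx _]]].
by have := anchors_indep vI xI; rewrite vx.
Qed.

(** Two anchors adjacent to [v] form an induced P_3 with [v] in the middle, and the missed anchors
    are independent and nonadjacent to it. *)
Lemma heavy_missed_anchors v :
  v \in heavy -> #|[set w in anchors | ~~ adj v w]| < k.
Proof.
case/heavyP=> x [y [xI yI xy vx vy]].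
apply: (P3_kP1_free_card hfree (a := x) (b := v) (c := y)) => //.
- by rewrite adj_sym.
- exact: anchors_indep.
- by move=> u w /setIdP[uI _] /setIdP[wI _]; apply: anchors_indep.
- by move=> w /setIdP[wI ->]; rewrite !anchors_indep.
Qed.

Lemma heavy_missed v : v \in heavy -> #|missed v| + ~~ adj v h < k.
Proof.
move=> vT; apply: leq_ltn_trans (heavy_missed_anchors vT).
have mc : missed v \subset c.
  by apply/subsetP=> x /setIdP[/attach_cycle].
rewrite -(card_imset (mem (missed v)) next_injective).
have mI : nx @: missed v \subset [set w in anchors | ~~ adj v w].
  apply/subsetP=> _ /imsetP[x /setIdP[xA vx] ->]; apply/setIdP; split=> //.
  by rewrite in_setU1 imset_f // orbT.
have [vh|vh] := boolP (adj v h); first by rewrite addn0 subset_leq_card.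
rewrite addnC.
have -> : (~~ false : nat) = (h \notin nx @: missed v) by rewrite h_notin_next.
rewrite -cardsU1 subset_leq_card // subUset mI andbT sub1set.
by apply/setIdP; rewrite setU11.
Qed.

(** Off the cycle, [v] would still be adjacent to at least k + 1 of the successors x+, and two are
    already impossible. *)
Lemma heavy_cycle v : v \in heavy -> v \in c.
Proof.
move=> vT; have [//|vc] := boolP (v \in c).
have lt := heavy_missed vT; exfalso.
have: 1 < #|attach :\: missed v|.
  have := cardsID (missed v) attach.
  have : #|attach :&: missed v| <= #|missed v| by rewrite subset_leq_card ?subsetIr.
  by move: lt A2k k2; case: (~~ _); clear; lia.
case/card_gt1P=> x [y [/setDP[xA xm] /setDP[yA ym] xy]].
have vx : adj v (nx x) by apply: contraNT xm => vx; apply/setIdP.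
have vy : adj v (nx y) by apply: contraNT ym => vy; apply/setIdP.
exact: attach_next_off xA yA xy vc vx vy.
Qed.

(** The anchors [h] and x+ are both adjacent to [x]. *)
Lemma nbr_heavy x : x \in c -> adj x h -> x \in heavy.
Proof.
move=> xc xh; have xA : x \in attach.
  by apply/attachP; split=> //; exists h; rewrite ?off_comp_h.
apply: (@heavyI x h (nx x)) => //; first exact: setU11.
- by apply/setU1P; right; apply: imset_f.
- by apply: contraNneq h_out => ->; rewrite mem_next.
- exact: adj_next.
Qed.

(** If t and t+ were both heavy, the threshold count would give |A| <= (k - 1) + (k - 1) + 1 <
    2k. *)
Lemma heavy_next t : t \in heavy -> nx t \notin heavy.
Proof.
move=> tT; apply/negP=> nT.
have tc := heavy_cycle tT.
have tA : t \notin attach.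
  apply/negP=> tA; have := disjointFl heavy_anchors nT.
  by rewrite in_setU1 imset_f ?orbT.
have [d Pd Wd] := arc_open cycle_arc tc.
have := @card_threshold _ attach (fun x => adj t (nx x))
  (fun x => adj (nx t) (nx x)) (index^~ d) (index_base_inj Pd).
have H : {in attach &, forall x y, index x d < index y d ->
    adj t (nx x) -> ~~ adj (nx t) (nx y)}.
  move=> x y xA yA xy tx; apply/negP.
  exact: (consecutive_crossing Pd Wd xA yA tA xy tx).
move/(_ H); have := heavy_missed tT; have := heavy_missed nT.
rewrite -/(missed t) -/(missed (nx t)).
move: A2k k2; clear; case: (~~ adj _ _); case: (~~ adj _ _); lia.
Qed.

(* A chord from [s+] to [t+] forces #|attach| <= #|missed s| + #|missed t| + 2
   by counting separately on the two arcs between [s] and [t]; this is too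
   small because [s], not being in [attach], also misses [h]. *)
Lemma heavy_next_nadj_out s t : s \in heavy -> t \in heavy -> t != s ->
  s \notin attach -> ~~ adj (nx s) (nx t).
Proof.
move=> sT tT ts sA; apply/negP=> st.
have sc := heavy_cycle sT; have tc := heavy_cycle tT.
have [d Pd Wd] := arc_open cycle_arc sc.
have inj := index_base_inj Pd.
pose A1 := [set x in attach | index x d < index t d].
pose A2 := [set x in attach | index t d < index x d].
have sA1 : A1 \subset attach by apply/subsetP=> x /setIdP[].
have sA2 : A2 \subset attach by apply/subsetP=> x /setIdP[].
have inj_sub (B : {set G}) : B \subset attach -> {in B &, injective (index^~ d)}.
  by move=> /subsetP sB x y xB yB; apply: inj; apply: sB.
have cardA : #|attach| <= #|A1| + #|A2| + (t \in attach).
  have sub : attach :\ t \subset A1 :|: A2.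
    apply/subsetP=> x /setD1P[xt xA]; rewrite in_setU.
    rewrite [x \in A1]in_set [x \in A2]in_set xA -neq_ltn; apply: contra xt => /eqP E.
    have td : t \in d by rewrite (perm_mem Pd).
    have xd : x \in d by rewrite (perm_mem Pd) attach_cycle.
    by rewrite -(nth_index t xd) E nth_index.
  rewrite (cardsD1 t) addnC leq_add2r.
  exact: leq_trans (subset_leq_card sub) (leq_card_setU _ _).
have split_missed v : #|[set x in A1 | ~~ adj v (nx x)]| +
    #|[set x in A2 | ~~ adj v (nx x)]| <= #|missed v|.
  rewrite -cardsUI [X in _ + X](_ : _ = 0) ?addn0.
    apply/subset_leq_card/subsetP=> x.
    by case/setUP=> /setIdP[/setIdP[xA _] vx]; apply/setIdP.
  apply/eqP; rewrite cards_eq0; apply/eqP/setP=> x; rewrite in_set0.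
  apply/negP=> /setIP[/setIdP[/setIdP[_ xt] _] /setIdP[/setIdP[_ tx] _]].
  by have := ltn_trans xt tx; rewrite ltnn.
have le2 : #|A2| <= #|[set x in A2 | ~~ adj s (nx x)]| +
    #|[set x in A2 | ~~ adj t (nx x)]| + 1.
  apply: (card_threshold (inj_sub _ sA2)) => y x.
  move=> /setIdP[yA ty] /setIdP[xA _] yx sy; apply/negP.
  exact: (chord_crossing_after Pd Wd tc st xA yA sA ty yx sy).
(* If [t] is in [attach], it costs 1 in [cardA] but the threshold is free here; otherwise the
   reverse holds. Either way the total excess is 2. *)
have le1 : #|A1| <= #|[set x in A1 | ~~ adj s (nx x)]| +
    #|[set x in A1 | ~~ adj t (nx x)]| + (t \notin attach).
  have [tA|tA] := boolP (t \in attach).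
    rewrite addn0; apply: leq_trans (leq_addr _ _).
    apply/subset_leq_card/subsetP=> x xA1; apply/setIdP; split=> //.
    case/setIdP: xA1 => xA xt; apply/negP.
    exact: (chord_attach_before Pd Wd tc ts st xA tA xt).
  (* On this arc the vertex [t] takes the first role in the threshold and [s] the second, opposite
     to [A2]. *)
  rewrite [X in _ <= X + _]addnC.
  apply: (card_threshold (inj_sub _ sA1)) => x y.
  move=> /setIdP[xA _] /setIdP[yA yt] xy tx; apply/negP.
  exact: (chord_crossing_before Pd Wd tc ts st xA yA xy yt tx).
have sh : ~~ adj s h.
  apply: contra sA => sh; apply/attachP; split=> //.
  by exists h; rewrite ?off_comp_h.
have := heavy_missed sT; have := heavy_missed tT; rewrite sh.
move: (split_missed s) (split_missed t) le1 le2 cardA A2k k2.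
by clear; case: (t \in attach); case: (~~ adj t h) => /=; lia.
Qed.

Lemma heavy_next_nadj s t : s \in heavy -> t \in heavy -> ~~ adj (nx s) (nx t).
Proof.
move=> sT tT; have [->|ts] := eqVneq t s; first by rewrite adj_irr.
have [sA|sA] := boolP (s \in attach); last exact: heavy_next_nadj_out.
have [tA|tA] := boolP (t \in attach).
  by apply: attach_next_indep; rewrite // eq_sym.
by rewrite adj_sym heavy_next_nadj_out // eq_sym.
Qed.

Lemma light_trans x y z : x \notin heavy -> y \notin heavy -> z \notin heavy ->
  adj x y -> adj y z -> x != z -> adj x z.
Proof.
move=> xT yT zT xy yz xz; apply/negPn/negP=> nxz.
pose N v := [set w in anchors | (w == v) || adj v w].
have N1 v : v \notin heavy -> #|N v| <= 1 by rewrite in_set -leqNgt.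
have: #|anchors :\: (N x :|: N y :|: N z)| < k.
  apply: (P3_kP1_free_card hfree xy yz xz nxz).
    by move=> u w /setDP[uI _] /setDP[wI _]; apply: anchors_indep.
  move=> w /setDP[wI wN]; apply/and3P; split; apply: contra wN => aw;
    rewrite 2!in_setU -orbA; apply/or3P; [apply: Or31 | apply: Or32 | apply: Or33];
    by apply/setIdP; rewrite aw orbT.
have := (leq_card_setU (N x) (N y)).1.
have := (leq_card_setU (N x :|: N y) (N z)).1.
have := N1 _ xT; have := N1 _ yT; have := N1 _ zT.
have : #|anchors :&: (N x :|: N y :|: N z)| <= #|N x :|: N y :|: N z|.
  by rewrite subset_leq_card ?subsetIr.
(* At least 2k + 1 - 3 anchors remain, and 2k - 2 >= k since k >= 2. *)
have := cardsID (N x :|: N y :|: N z) anchors; rewrite card_anchors.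
by move: A2k k2; clear; lia.
Qed.

(** Transitivity contracts a path step by step: the components left after deleting [heavy] are
    cliques. *)
Lemma light_connect (x y : del_verts heavy) :
  connect (@adj (del_verts heavy)) x y -> x = y \/ adj (val x) (val y).
Proof.
case/connectP=> p; elim: p x => [|z p IH] x /=; first by move=> _ ->; left.
case/andP=> xz pz Ey; case: (IH z pz Ey) => [<-|zy]; first by right.
have [xy|xNy] := eqVneq x y; [by left | right].
exact: light_trans (valP x) (valP z) (valP y) xz zy xNy.
Qed.

(** Each clique component contains at most one vertex of [I]. *)
Lemma light_indep_card (I : {set G}) : [disjoint I & heavy] ->
  {in I &, forall x y, ~~ adj x y} -> #|I| <= num_comp (del_verts heavy).
Proof.
move=> dI iI; apply: num_comp_del_ge dI _ => x y xI yI /light_connect[//|e].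
by have := iI _ _ xI yI; rewrite e.
Qed.

Lemma not_tough1 : ~ tough 1%R G.
Proof.
move=> Gt.
(* The anchors only certify that [heavy] is a cut; the sharper count comes from heavy successors
   together with [h]. *)
have c2 : 2 <= num_comp (del_verts heavy).
  apply: leq_trans (light_indep_card heavy_anchors anchors_indep).
  by rewrite card_anchors; move: A2k k2; clear; lia.
have := tough1_cut Gt c2; rewrite leqNgt => /negP; apply.
have hc : heavy \subset c by apply/subsetP=> x /heavy_cycle.
have <- : #|h |: nx @: heavy| = #|heavy|.+1.
  by rewrite cardsU1 h_notin_next // card_imset //; apply: next_injective.
(* If [h] were adjacent to t+, then t+ would be heavy right after the heavy vertex t. *)
have h_next t : t \in heavy -> ~~ adj h (nx t).
  move=> tT; apply: contra (heavy_next tT) => ht; apply: nbr_heavy.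
    by rewrite mem_next heavy_cycle.
  by rewrite adj_sym.
apply: light_indep_card.
  rewrite disjoint_subset; apply/subsetP=> x /setU1P[->|/imsetP[t tT ->]].
    by apply: contra h_out => /heavy_cycle.
  exact: heavy_next.
move=> x y /setU1P[->|/imsetP[s sT ->]] /setU1P[->|/imsetP[t tT ->]].
- by rewrite adj_irr.
- exact: h_next.
- by rewrite adj_sym h_next.
- exact: heavy_next_nadj.
Qed.

End Tough.
End LongestCycle.

(** * Existence of a longest cycle and the conclusion *)

Lemma m_connected_edge (G : sgraph) m : m_connected m G -> 0 < m -> 1 < #|G| ->
  exists x y : G, adj x y.
Proof.
move=> Gm m0 G2; have [[x y] /= xy|no_edge] := pickP [pred p : G * G | adj p.1 p.2].
  by exists x, y.
(* Without edges the empty set is already a cut, every vertex being its own component. *)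
have : m <= #|@set0 G|.
  apply: m_connected_cut Gm _; apply: leq_trans G2 _; rewrite -cardsT.
  apply: num_comp_del_ge; first by rewrite disjoints_subset setC0 subsetT.
  move=> x y _ _ /connectP[[|z p] /=]; first by [].
  by case/andP=> + _ _; rewrite /del_rel; have /= -> := no_edge (val x, val z).
by rewrite cards0 leqNgt m0.
Qed.

Lemma longest_cycle (G : sgraph) : exists c : seq G,
  [/\ cycle (@adj G) c, uniq c &
      forall s : seq G, cycle (@adj G) s -> uniq s -> size s <= size c].
Proof.
pose P n := [exists t : n.-tuple G, cycle (@adj G) t && uniq t].
(* The empty list counts as a cycle here. *)
have P0 : exists n, P n by exists 0; apply/existsP; exists [tuple].
have Pb n : P n -> n <= #|G|.
  case/existsP=> t /andP[_ Ut]; rewrite -(size_tuple t) -(card_uniqP Ut).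
  exact: max_card.
case: (ex_maxnP P0 Pb) => n /existsP[t /andP[Ct Ut]] n_max.
exists t; split=> // s Cs Us; rewrite size_tuple; apply: n_max.
by apply/existsP; exists (in_tuple s); rewrite /= Cs.
Qed.

Theorem theorem1p1 (k : nat) (hk : 2 <= k) (G : sgraph)
    (hconn : m_connected (2 * k) G) (htough : tough 1%R G)
    (hfree : induced_free
      (disjoint_union (path_graph 3) (copies k (path_graph 1))) G) :
  hamiltonian G.
Proof.
have [c [Cc Uc c_max]] := longest_cycle G.
have G4 : 4 <= #|G|.
  by apply: leq_trans (m_connected_card hconn); rewrite (leq_mul2l 2 2).
have [h h_out|c_all] := pickP [pred h | h \notin c].
  have [x [y xy]] : exists x y : G, adj x y.
    apply: m_connected_edge hconn _ _; last exact: leq_trans G4.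
    by rewrite muln_gt0 (ltnW hk).
  (* An edge traversed back and forth is a duplicate-free [cycle] of size 2, so the longest one is
     nonempty. *)
  have c0 : 0 < size c.
    have /c_max : cycle (@adj G) [:: x; y] by rewrite /= xy adj_sym xy.
    move=> H; apply: leq_trans (H _) => //=; rewrite inE andbT.
    by apply: contraTneq xy => ->; rewrite adj_irr.
  have A2k := attach_card Cc Uc c_max h_out hconn c0.
  by case: (not_tough1 Cc Uc c_max h_out hk A2k hfree).
have c_mem x : x \in c by apply/negbFE/c_all.
exists c; split=> //; first by rewrite /ucycle Cc.
apply: (@leq_trans #|G|); first exact: ltnW.
apply: leq_trans (card_size c); apply/subset_leq_card/subsetP=> x _.
exact: c_mem.
Qed.
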